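(* There is a randomized algorithm (always returning the correct answer) that solves rooted Subtree Isomorphism on two rooted ternary trees $H$ and $G$, each with $O(n)$ vertices and height at most $h$, in expected time $O(\min\{6.107^h, n^2\})$.
   Context: A rooted ternary tree is a rooted tree in which every vertex has at most $3$ children. Rooted Subtree Isomorphism: given rooted unordered trees $H$ and $G$, decide whether $H$ is isomorphic to a subtree of $G$, i.e. whether there is an injective map $f$ from the vertices of $H$ to the vertices of $G$ with $f(\mathrm{root}(H))=\mathrm{root}(G)$ such that whenever $c$ is a child of $p$ in $H$, $f(c)$ is a child of $f(p)$ in $G$. The height of a rooted tree is the maximum number of edges on a root-to-leaf path. *)

(* Defs.v *)
From HB Require Import structures.
From mathcomp Require Import all_boot all_order all_algebra.
From mathcomp Require Import all_classical all_reals all_analysis.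
From Stdlib Require List.

Set Implicit Arguments.
Unset Strict Implicit.
Unset Printing Implicit Defensive.

Import Order.TTheory GRing.Theory Num.Theory.

Local Open Scope nat_scope.

(* The list fixes an order of the children, as any machine representation of an
   unordered tree does; [subtree_iso] below does not depend on that order. *)
Inductive rtree := Node of seq rtree.

Definition children (t : rtree) : seq rtree := let: Node ts := t in ts.

(* A vertex is named by the list of child indices leading to it from the root,
   so the root is [::] and [vertex t p] says that p names a vertex of t. *)
Fixpoint vertex (t : rtree) (p : seq nat) : bool :=
  if p is i :: q then
    (i < size (children t)) && vertex (nth (Node [::]) (children t) i) q
  else true.

Definition child_of (t : rtree) (p c : seq nat) : Prop :=
  [/\ vertex t p, vertex t c & exists i, c = rcons p i].

Fixpoint ternary (t : rtree) : bool :=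
  let: Node ts := t in (size ts <= 3) && all ternary ts.

Fixpoint num_vertices (t : rtree) : nat :=
  let: Node ts := t in (sumn (map num_vertices ts)).+1.

Fixpoint height (t : rtree) : nat :=
  let: Node ts := t in foldr maxn 0 (map (fun u => (height u).+1) ts).

Definition subtree_iso (H G : rtree) : Prop :=
  exists f : seq nat -> seq nat,
    [/\ forall u, vertex H u -> vertex G (f u),
        {in vertex H &, injective f},
        f [::] = [::]
      & forall p c, child_of H p c -> child_of G (f p) (f c)].

(* Randomized version of the language WHILE of N. D. Jones (Computability and
   Complexity from a Programming Perspective, MIT Press, 1997): finitely many
   variables ranging over binary trees, unit-cost elementary operations, each
   of which a word RAM performs in constant time on linked cells. There is no
   arithmetic and no test on trees other than "is it DNil". *)
Inductive data := DNil | DCons of data & data.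

Definition hd (d : data) : data := if d is DCons a _ then a else DNil.
Definition tl (d : data) : data := if d is DCons _ b then b else DNil.
Definition is_cons (d : data) : bool := if d is DCons _ _ then true else false.

Definition store := nat -> data.

Definition update (s : store) (x : nat) (d : data) : store :=
  fun y => if y == x then d else s y.

Inductive operation :=
  | OpNil
  | OpVar of nat
  | OpCons of nat & nat
  | OpHd of nat
  | OpTl of nat.

Definition eval_op (s : store) (o : operation) : data :=
  match o with
  | OpNil => DNil
  | OpVar x => s x
  | OpCons x y => DCons (s x) (s y)
  | OpHd x => hd (s x)
  | OpTl x => tl (s x)
  end.

(* DNil is false and every other tree is true. [Choose b bs] runs one of the
   blocks b :: bs, chosen uniformly at random and independently of the past. *)
Inductive command :=
  | Assign of nat & operation
  | If of nat & seq command & seq command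
  | While of nat & seq command
  | Choose of seq command & seq (seq command).

Definition program := seq command.

(* The commands still to be executed, and the store; the machine has halted
   when no command is left. *)
Definition config := (program * store)%type.

Definition halted (c : config) : bool := nilp c.1.

(* The equally likely successors of a configuration, with multiplicity; there
   is at least one unless the machine has halted. Each step costs one unit. *)
Definition step (c : config) : seq config :=
  let: (p, s) := c in
  match p with
  | [::] => [::]
  | Assign x o :: k => [:: (k, update s x (eval_op s o))]
  | If x b1 b2 :: k => [:: ((if is_cons (s x) then b1 else b2) ++ k, s)]
  | While x b :: k => [:: (if is_cons (s x) then b ++ p else k, s)]
  | Choose b bs :: k => [seq (b' ++ k, s) | b' <- b :: bs]
  end.

(* [reaches c c']: some outcome of the random choices leads from c to c'. *)
Inductive reaches : config -> config -> Prop :=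
  | reaches_refl c : reaches c c
  | reaches_step c c1 c2 :
      List.In c1 (step c) -> reaches c1 c2 -> reaches c c2.

Section ExpectedTime.
Variable R : realType.

(* The probability that the run from c makes exactly t steps before halting. *)
Fixpoint prob_time (c : config) (t : nat) : R :=
  (if t is u.+1 then
     if halted c then 0
     else (\sum_(c' <- step c) prob_time c' u) / (size (step c))%:R
   else (halted c)%:R)%R.

(* The expectation of the running time, a random variable with values in
   {0, 1, 2, ...} and +oo. The last factor is the probability of running
   forever; by the library's convention +oo * 0 = 0. *)
Definition expected_time (c : config) : \bar R :=
  (\sum_(0 <= t <oo) (t%:R * prob_time c t)%:E
   + +oo * (1 - \sum_(0 <= t <oo) (prob_time c t)%:E))%E.

End ExpectedTime.

(* A tree is stored as the nil-terminated linked list of its children. *)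
Fixpoint encode (t : rtree) : data :=
  let: Node ts := t in foldr (fun u l => DCons (encode u) l) DNil ts.

(* H and G are given in variables 0 and 1; the other variables hold DNil. *)
Definition initial (P : program) (H G : rtree) : config :=
  (P, fun x => if x == 0 then encode H else if x == 1 then encode G else DNil).

(* The answer is returned in variable 0. *)
Definition answer (s : store) : bool := is_cons (s 0).

(* No outcome of the random choices yields a wrong answer. *)
Definition always_correct_on_ternary (P : program) : Prop :=
  forall H G : rtree, ternary H -> ternary G ->
  forall c : config, reaches (initial P H G) c -> halted c ->
  answer c.2 <-> subtree_iso H G.

(* Main.v *)
Require Import Defs.
From mathcomp Require Import all_boot all_order all_algebra.
From mathcomp Require Import all_classical all_reals all_analysis.
From mathcomp Require Import zify ring lra.
Import Order.TTheory GRing.Theory Num.Theory.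
Local Open Scope ring_scope.

(* H embeds in G with roots matched iff the Boolean matrix telling which children
   of H embed in which children of G, padded to size 3 x 3, has a perfect matching.
   Permute its rows and columns at random and query its entries, recursively,
   following a fixed decision tree for perfect matching. That tree makes at most
   218/36 < 6.107 queries on average over the 36 permutations, whatever the matrix
   is, so the expected time is O(6.107^h). It never repeats a query, hence a pair
   of vertices is compared at most once, which gives O(n^2). Both bounds come from
   one simulation argument, applied to two solutions of the recursive inequality
   that the cost of a comparison must satisfy. *)

Set Implicit Arguments.
Unset Strict Implicit.
Unset Printing Implicit Defensive.

(** * Rooted embeddings described child by child *)

Section Embeddings.
Local Open Scope nat_scope.

Lemma vertex_rcons t p i : vertex t (rcons p i) -> vertex t p.
Proof.
elim: p t => [|k p IH] t //=.
by case/andP=> -> /= /IH.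
Qed.

Lemma child_of_cons ts i p c : i < size ts ->
  child_of (nth (Node [::]) ts i) p c -> child_of (Node ts) (i :: p) (i :: c).
Proof.
move=> lt_i [vp vc [k def_c]]; split; rewrite /= ?lt_i //.
by exists k; rewrite def_c.
Qed.

(** Passing to a child appends one index to a path, so all vertices below child [i] are sent below
    one child [j]. Stripping the first index of their images gives the embedding of the subtree. *)
Lemma subtree_iso_child ts us (f : seq nat -> seq nat) i :
    (forall u, vertex (Node ts) u -> vertex (Node us) (f u)) ->
    {in vertex (Node ts) &, injective f} -> f [::] = [::] ->
    (forall p c, child_of (Node ts) p c -> child_of (Node us) (f p) (f c)) ->
    i < size ts ->
  exists j, [/\ j < size us, f [:: i] = [:: j] &
    subtree_iso (nth (Node [::]) ts i) (nth (Node [::]) us j)].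
Proof.
move=> f_vertex f_inj f_root f_child lt_i.
have vi : vertex (Node ts) [:: i] by rewrite /= lt_i.
have [_ vj [j]] : child_of (Node us) (f [::]) (f [:: i]).
  by apply: f_child; split=> //; exists i.
rewrite f_root /= => fi; rewrite fi /= andbT in vj.
exists j; split=> //.
have vcons u : vertex (nth (Node [::]) ts i) u -> vertex (Node ts) (i :: u).
  by rewrite /= lt_i.
have f_cons u : vertex (nth (Node [::]) ts i) u -> f (i :: u) = j :: behead (f (i :: u)).
  (* The induction removes the last index, since that is where [child_of] extends a path. *)
  elim/last_ind: u => [|u k IH] vuk; first by rewrite fi.
  have vu := vertex_rcons vuk.
  have [_ _ [m ->]] : child_of (Node us) (f (i :: u)) (f (i :: rcons u k)).
    by apply: f_child; apply: child_of_cons => //; split=> //; exists k.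
  by rewrite IH.
exists (fun u => behead (f (i :: u))); split=> [u vu|u v vu vv eq_uv||p c pc].
- by have := f_vertex _ (vcons _ vu); rewrite f_cons //= => /andP[].
- have : f (i :: u) = f (i :: v) by rewrite f_cons // eq_uv -f_cons.
  by move=> /f_inj -/(_ (vcons _ vu) (vcons _ vv)) [].
- by rewrite fi.
case: (pc) => vp vc _.
have [] := f_child _ _ (child_of_cons lt_i pc).
rewrite (f_cons p) // (f_cons c) //= => /andP[_ vfp] /andP[_ vfc] [k [eq_k]].
by split=> //; exists k.
Qed.

Lemma subtree_isoP ts us :
  subtree_iso (Node ts) (Node us) <->
  exists g : nat -> nat,
    [/\ forall i, i < size ts -> g i < size us,
        {in gtn (size ts) &, injective g}
      & forall i, i < size ts ->
          subtree_iso (nth (Node [::]) ts i) (nth (Node [::]) us (g i))].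
Proof.
split=> [[f [f_vertex f_inj f_root f_child]]|[g [g_lt g_inj g_iso]]].
  have child_f := subtree_iso_child f_vertex f_inj f_root f_child.
  exists (fun i => head 0 (f [:: i])); split=> [i|i k|i] lt_i.
  - by have [j [ltj ->]] := child_f i lt_i.
  - move=> lt_k; have [j [_ fi _]] := child_f i lt_i.
    have [j' [_ fk _]] := child_f k lt_k.
    rewrite fi fk /= => eq_j; rewrite eq_j -fk in fi.
    have [//] : [:: i] = [:: k] by apply: f_inj fi; rewrite unfold_in /= andbT.
  - by have [j [_ ->]] := child_f i lt_i.
(* Conversely, one embedding is chosen for each child, with [id] as a default out of range. They are
   glued by applying [g] to the first index and the chosen map to the rest. *)
have /boolp.choice[f f_iso] : forall i, exists f : seq nat -> seq nat, i < size ts ->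
    [/\ forall u, vertex (nth (Node [::]) ts i) u ->
          vertex (nth (Node [::]) us (g i)) (f u),
        {in vertex (nth (Node [::]) ts i) &, injective f}, f [::] = [::]
      & forall p c, child_of (nth (Node [::]) ts i) p c ->
          child_of (nth (Node [::]) us (g i)) (f p) (f c)].
  move=> i; case: (ltnP i (size ts)) => [/g_iso[f f_iso]|_]; first by exists f.
  by exists id.
exists (fun u => if u is i :: v then g i :: f i v else [::]); split=> //.
- case=> [|i u] //= /andP[lt_i vu].
  rewrite g_lt //=; have [fv _ _ _] := f_iso _ lt_i; exact: fv.
- case=> [|i u] [|k v] //; rewrite !unfold_in /= => /andP[lt_i vu] /andP[lt_k vv] [].
  move=> /g_inj -/(_ lt_i lt_k) eq_ik; subst k => eq_uv.
  by have [_ /(_ u v vu vv eq_uv) -> _ _] := f_iso _ lt_i.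
move=> p c [vp vc [k def_c]]; subst c.
case: p => [|i p] in vp vc *.
  move: vc => /= /andP[lt_k _]; have [_ _ -> _] := f_iso _ lt_k.
  by split=> //=; [rewrite g_lt | exists (g k)].
move: vp vc => /= /andP[lt_i vp] /andP[_ vc].
have [_ _ _ /(_ p (rcons p k)) []] := f_iso _ lt_i; first by split=> //; exists k.
move=> vfp vfc [m eq_m].
by split=> /=; rewrite ?g_lt //; exists m; rewrite eq_m.
Qed.

End Embeddings.

(** * Decision trees for perfect matching in a 3 x 3 matrix *)

Section QueryStrategies.
Local Open Scope nat_scope.

Inductive strategy :=
  | Answer of bool
  | Query of 'I_3 & 'I_3 & strategy & strategy.

Fixpoint outcome (s : strategy) (M : 'I_3 -> 'I_3 -> bool) : bool :=
  match s with
  | Answer b => b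
  | Query i j s1 s0 => outcome (if M i j then s1 else s0) M
  end.

Fixpoint queries (s : strategy) (M : 'I_3 -> 'I_3 -> bool) : seq ('I_3 * 'I_3) :=
  match s with
  | Answer _ => [::]
  | Query i j s1 s0 => (i, j) :: queries (if M i j then s1 else s0) M
  end.

Definition o0 : 'I_3 := @Ordinal 3 0 isT.
Definition o1 : 'I_3 := @Ordinal 3 1 isT.
Definition o2 : 'I_3 := @Ordinal 3 2 isT.

Definition perms3 : seq (seq 'I_3) :=
  [:: [:: o0; o1; o2]; [:: o0; o2; o1]; [:: o1; o0; o2];
      [:: o1; o2; o0]; [:: o2; o0; o1]; [:: o2; o1; o0]].

Definition sel (p : seq 'I_3) (i : 'I_3) : 'I_3 := nth o0 p i.

Definition perfect_matching (M : 'I_3 -> 'I_3 -> bool) : bool :=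
  has (fun p => [&& M o0 (sel p o0), M o1 (sel p o1) & M o2 (sel p o2)]) perms3.

Local Notation Y := (Answer true).
Local Notation N := (Answer false).
Local Notation "'Q' i j s1 s0" := (Query i j s1 s0)
  (at level 10, i, j, s1, s0 at level 9).

(* Found by a computer search (multiplicative weights against an adversary who
   chooses the matrix, then local improvement). The first branch of a query is
   taken when the entry is true. *)
Definition match_strategy : strategy :=
  Q o2 o2
    (Q o1 o1
      (Q o0 o0
        Y
        (Q o2 o0
          (Q o0 o2 Y (Q o1 o2 (Q o0 o1 Y N) (Q o1 o0 (Q o0 o1 Y N) N)))
          (Q o0 o1 (Q o1 o0 Y N) (Q o2 o1 (Q o1 o0 (Q o0 o2 Y N) N) N))))
      (Q o1 o0
        (Q o0 o1 Y (Q o0 o2 (Q o2 o1 Y N) (Q o1 o2 (Q o2 o1 (Q o0 o0 Y N) N) N)))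
        (Q o1 o2
          (Q o2 o1 (Q o0 o0 Y (Q o2 o0 (Q o0 o1 Y N) N)) (Q o2 o0 (Q o0 o1 Y N) N))
          N)))
    (Q o1 o2
      (Q o2 o1
        (Q o0 o0
          Y
          (Q o0 o2
            (Q o1 o0 Y (Q o1 o1 (Q o2 o0 Y N) (Q o0 o1 (Q o2 o0 Y N) N)))
            (Q o2 o0 (Q o0 o1 Y N) N)))
        (Q o0 o1 (Q o2 o0 Y N) (Q o0 o2 (Q o1 o1 (Q o2 o0 Y N) N) N)))
      (Q o2 o1
        (Q o0 o2 (Q o1 o0 Y (Q o2 o0 (Q o1 o1 Y N) N)) N)
        (Q o1 o1 (Q o2 o0 (Q o0 o2 Y N) N) N))).

Definition matrix_of (m : seq bool) (i j : 'I_3) : bool := nth false m (3 * i + j).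

Fixpoint bitseqs n : seq (seq bool) :=
  if n is m.+1 then [seq b :: s | b <- [:: true; false], s <- bitseqs m] else [:: [::]].

Lemma mem_bitseqs (s : seq bool) : s \in bitseqs (size s).
Proof.
elim: s => //= b s IH; rewrite !mem_cat.
by case: b; rewrite map_f ?orbT.
Qed.

Lemma matrix_cases (M : 'I_3 -> 'I_3 -> bool) :
  exists2 m, m \in bitseqs 9 & M = matrix_of m.
Proof.
exists [:: M o0 o0; M o0 o1; M o0 o2; M o1 o0; M o1 o1; M o1 o2; M o2 o0; M o2 o1; M o2 o2].
  exact: mem_bitseqs.
do 2![apply/boolp.funext; case=> [[|[|[|//]]] ?]]; rewrite /matrix_of /=;
  congr (M _ _); exact: val_inj.
Qed.

Definition permuted (p q : seq 'I_3) (M : 'I_3 -> 'I_3 -> bool) (i j : 'I_3) :=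
  M (sel p i) (sel q j).

(** Correctness and invariance under permutations yield the right answer, the absence of repeated
    queries yields the quadratic bound, and 218 yields the exponential one. *)
Definition match_strategy_ok (M : 'I_3 -> 'I_3 -> bool) : bool :=
  [&& outcome match_strategy M == perfect_matching M,
      uniq (queries match_strategy M),
      all (fun p => all (fun q =>
        perfect_matching (permuted p q M) == perfect_matching M) perms3) perms3
    & sumn [seq size (queries match_strategy (permuted p q M)) | p <- perms3, q <- perms3] <= 218].

(** Checked by computation on all 512 matrices. *)
Lemma match_strategy_okP M : match_strategy_ok M.
Proof.
have [m m_in ->] := matrix_cases M.
have /allP : all (fun m => match_strategy_ok (matrix_of m)) (bitseqs 9) by vm_compute.
exact.
Qed.

End QueryStrategies.

(** * Embeddings as perfect matchings of the padded matrix *)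

Section Matching.
Local Open Scope nat_scope.

Definition kids (t : rtree) (i : 'I_3) : option rtree :=
  if i < size (children t) then Some (nth (Node [::]) (children t) i) else None.

(** A missing child of H fits anywhere and a missing child of G receives no actual child, so the
    padding leaves exactly the injections between actual children. *)
Definition embeds (x y : option rtree) : bool :=
  match x, y with
  | None, _ => true
  | Some _, None => false
  | Some H, Some G => `[< subtree_iso H G >]
  end.

(** An embedding gives an injection on the children present only, while a perfect matching is a full
    permutation. The extension is found by cases on [m] and the values of [g]. *)
Lemma perms3_extend m (g : nat -> nat) : m <= 3 ->
    (forall i, i < m -> g i < 3) -> {in gtn m &, injective g} ->
  exists2 p, p \in perms3 & forall i : 'I_3, i < m -> sel p i = g i :> nat.
Proof.
move=> le_m lt_g inj_g.
have inj i k : i < m -> k < m -> i != k -> g i != g k.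
  by move=> lt_i lt_k; apply: contra_neq => /inj_g; apply.
suff /hasP[p p_in /allP eq_g] : has (fun p => all (fun i : 'I_3 =>
    (i < m) ==> (sel p i == g i :> nat)) [:: o0; o1; o2]) perms3.
  exists p => // i lt_i; apply/eqP/(implyP (eq_g i _)) => //.
  by case: i {lt_i} => [[|[|[|//]]] ?]; rewrite !inE -!val_eqE /=.
case: m le_m lt_g inj {inj_g} => [|[|[|[|//]]]] _ lt_g inj //=.
- by move: (g 0) (lt_g 0 isT) => [|[|[|//]]].
- move: (lt_g 0 isT) (lt_g 1 isT) (inj 0 1 isT isT isT).
  by case: (g 0) => [|[|[|//]]] _; case: (g 1) => [|[|[|//]]] _.
- move: (lt_g 0 isT) (lt_g 1 isT) (lt_g 2 isT).
  move: (inj 0 1 isT isT isT) (inj 0 2 isT isT isT) (inj 1 2 isT isT isT).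
  case: (g 0) => [|[|[|?]]]; case: (g 1) => [|[|[|?]]]; case: (g 2) => [|[|[|?]]] //.
Qed.

Lemma perms3_inj p : p \in perms3 -> {in gtn 3 &, injective (nth o0 p)}.
Proof.
move=> p_in; have /allP/(_ p p_in)/andP[/eqP sz_p un_p] :
  all (fun p : seq 'I_3 => (size p == 3) && uniq p) perms3 by [].
by move=> i k lt_i lt_k /eqP; rewrite nth_uniq ?sz_p // => /eqP.
Qed.

Lemma perfect_matchingP (M : 'I_3 -> 'I_3 -> bool) : reflect
  (exists2 p, p \in perms3 & forall i, M i (sel p i)) (perfect_matching M).
Proof.
apply: (iffP hasP) => [[p p_in /and3P[m0 m1 m2]]|[p p_in Mp]]; exists p => //.
  by case=> [[|[|[|//]]] lt_i]; [move: m0|move: m1|move: m2];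
    congr (M _ (sel p _)); apply: val_inj.
by rewrite !Mp.
Qed.

(** By [subtree_isoP], an embedding amounts to an injection of the children. It extends to a
    permutation by [perms3_extend], and conversely a matching restricts to the actual children. *)
Lemma embeds_matching H G : ternary H -> ternary G ->
  embeds (Some H) (Some G) = perfect_matching (fun i j => embeds (kids H i) (kids G j)).
Proof.
case: H G => [ts] [us] /= /andP[le_ts _] /andP[le_us _].
apply/asboolP/perfect_matchingP => [/subtree_isoP[g [g_lt g_inj g_iso]]|[p p_in Mp]].
  have [i lt_i|p p_in eq_g] := perms3_extend le_ts _ g_inj.
    exact: leq_trans (g_lt i lt_i) le_us.
  exists p => // i; rewrite /kids /=; case: ltnP => // lt_i.
  by rewrite eq_g // g_lt //=; apply/asboolP/g_iso.
have Mi i : i < size ts -> exists2 lt_p : nth o0 p i < size us,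
    true & subtree_iso (nth (Node [::]) ts i) (nth (Node [::]) us (nth o0 p i)).
  move=> lt_i; have := Mp (Ordinal (leq_trans lt_i le_ts)).
  by rewrite /kids /= lt_i /sel /=; case: ifP => //= lt_p /asboolP iso; exists isT.
apply/subtree_isoP; exists (fun i => nth o0 p i); split=> [i /Mi[]||i /Mi[]] //.
move=> i k lt_i lt_k /val_inj; apply: (perms3_inj p_in).
- exact: leq_trans lt_i le_ts.
- exact: leq_trans lt_k le_ts.
Qed.

End Matching.

(** * Certificates for answers and expected running times *)

Section Runs.
Variable F : realFieldType.
Variable ans : bool.

(** A well-founded certificate that all runs from a configuration halt with answer [ans], and that
    [r] bounds their expected length. One object thus serves both correctness and cost. *)
Inductive run : config -> F -> Prop :=
  | run_halt s r : answer s = ans -> 0 <= r -> run ([::], s) r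
  | run_step c (rs : seq F) r :
      size rs = size (step c) -> (0 < size rs)%N ->
      (forall i, (i < size rs)%N -> run (nth c (step c) i) (nth 0 rs i)) ->
      1 + (\sum_(x <- rs) x) / (size rs)%:R <= r ->
      run c r.

Lemma run_le c r r' : r <= r' -> run c r -> run c r'.
Proof.
move=> le_r run_c; case: run_c le_r => [s q ans_s q0|d rs q sz rs0 runs le_q] le_r.
  by apply: run_halt => //; lra.
by apply: (run_step sz rs0 runs); lra.
Qed.

Lemma run_det c c' r : step c = [:: c'] -> run c' (r - 1) -> run c r.
Proof.
move=> def_c run_c'; apply: (@run_step c [:: r - 1]); rewrite ?def_c //.
  by case.
by rewrite big_seq1 divr1; lra.
Qed.

Lemma run_assign x o k s r :
  run (k, update s x (eval_op s o)) (r - 1) -> run (Assign x o :: k, s) r.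
Proof. exact: run_det. Qed.

Lemma run_if x b1 b2 k s r :
  run ((if is_cons (s x) then b1 else b2) ++ k, s) (r - 1) -> run (If x b1 b2 :: k, s) r.
Proof. exact: run_det. Qed.

Lemma run_while x b k s r :
  run (if is_cons (s x) then b ++ While x b :: k else k, s) (r - 1) ->
  run (While x b :: k, s) r.
Proof. by apply: run_det. Qed.

Lemma run_choose (I : eqType) (i : I) (js : seq I) (blk : I -> program) k s (f : I -> F) r :
    (forall j, j \in i :: js -> run (blk j ++ k, s) (f j)) ->
    \sum_(j <- i :: js) f j <= (size js).+1%:R * (r - 1) ->
  run (Choose (blk i) [seq blk j | j <- js] :: k, s) r.
Proof.
move=> runs le_r.
apply: (@run_step _ [seq f j | j <- i :: js]) => [||n|]; rewrite ?size_map //.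
- by rewrite /= !size_map.
- move=> lt_n; rewrite /step -(map_cons blk) -map_comp.
  by rewrite !(nth_map i) //; apply: runs; rewrite mem_nth.
- by rewrite big_map -lerBrDl ler_pdivrMr ?ltr0n // mulrC.
Qed.

Lemma In_nth T (x0 x : T) (s : seq T) : List.In x s ->
  exists2 i, (i < size s)%N & x = nth x0 s i.
Proof.
elim: s => //= y s IH [->|/IH[i lt_i ->]]; first by exists 0%N.
by exists i.+1.
Qed.

Lemma run_answer c r c' : run c r -> reaches c c' -> halted c' -> answer c'.2 = ans.
Proof.
move=> run_c reach_c; elim: reach_c r run_c => {c c'} [c|c c1 c2 in_c1 _ IH] r run_c halt.
  case: run_c halt => [s q -> //|d rs q sz rs0 _ _].
  by case: d sz => [[|? ?] s] //= sz; rewrite sz in rs0.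
move: in_c1; case: run_c => [s q //|d rs q sz rs0 runs _].
move=> /(In_nth d)[i lt_i def_c1]; apply: (IH (nth 0 rs i)) => //.
by rewrite def_c1; apply: runs; rewrite sz.
Qed.

End Runs.

(** * From certificates to the expected time *)

Section ExpectedTimeBound.
Variable R : realType.

Lemma uniform_bound n (P : nat -> nat -> Prop) :
    (forall i, (i < n)%N -> exists N, forall M, (N <= M)%N -> P i M) ->
  exists N, forall M, (N <= M)%N -> forall i, (i < n)%N -> P i M.
Proof.
elim: n => [|n IH] bound; first by exists 0%N.
have [i lt_i|N PN] := IH; first by apply: bound; apply: ltnW.
have [N' PN'] := bound n (ltnSn n).
exists (maxn N N') => M; rewrite geq_max => /andP[le_N le_N'] i.
by rewrite ltnS leq_eqVlt => /predU1P[->|/(PN _ le_N)] //; apply: PN'.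
Qed.

(** A certificate is finite and finitely branching, so the lengths of all runs have a common bound
    [N], beyond which the series defining the expected time have only zero terms. *)
Lemma run_prob_time ans (c : config) (r : R) : run ans c r ->
  exists N, forall M, (N <= M)%N ->
    [/\ prob_time R c M = 0, \sum_(t < M) prob_time R c t = 1 &
        \sum_(t < M) t%:R * prob_time R c t <= r].
Proof.
elim=> {c r} [s r _ r0|c rs r sz rs0 _ IH le_r].
  exists 1%N => -[//|M] _; split=> //.
    by rewrite big_ord_recl big1 ?addr0 // => i _.
  by rewrite big_ord_recl big1 ?mul0r ?addr0 // => i _; rewrite mulr0.
have [N PN] := uniform_bound IH.
have c_run : halted c = false.
  by case: c sz {IH PN} => [[|? ?] s] //= sz; rewrite sz in rs0.
exists N.+1 => -[//|M] leM; have {PN} P i lt_i := PN M leM i lt_i.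
have probS t : prob_time R c t.+1 =
    (\sum_(i < size rs) prob_time R (nth c (step c) i) t) / (size rs)%:R.
  by rewrite /= c_run sz (big_nth c) big_mkord.
have n0 : (size rs)%:R != 0 :> R by rewrite pnatr_eq0 -lt0n.
have prob0 : prob_time R c 0 = 0 by rewrite /= c_run.
have sum1 : \sum_(t < M) prob_time R c t.+1 = 1.
  under eq_bigr do rewrite probS.
  rewrite -mulr_suml exchange_big /=.
  under eq_bigr => i _ do have [_ -> _] := P i (ltn_ord i).
  by rewrite sumr_const card_ord divff.
split.
- rewrite probS big1 ?mul0r // => i _.
  by have [->] := P i (ltn_ord i).
- by rewrite big_ord_recl prob0 add0r.
rewrite big_ord_recl mul0r add0r.
apply: le_trans le_r.
have mulSr1 (t : nat) (x : R) : t.+1%:R * x = t%:R * x + x by rewrite -natr1 mulrDl mul1r.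
(* The time is one step plus the time after it: splitting [t.+1] as [t + 1] leaves the total mass,
   which is 1. *)
have -> : \sum_(t < M) (lift ord0 t)%:R * prob_time R c (lift ord0 t)
    = 1 + \sum_(t < M) t%:R * prob_time R c t.+1.
  rewrite -[X in _ = X + _]sum1 addrC -big_split; apply: eq_bigr => t _.
  by rewrite lift0; exact: mulSr1.
rewrite lerD2l.
under eq_bigr => t _ do rewrite probS mulrA mulr_sumr.
rewrite -mulr_suml ler_pM2r ?invr_gt0 ?ltr0n // exchange_big /=.
rewrite (big_nth 0) big_mkord; apply: ler_sum => i _.
by have [_ _] := P i (ltn_ord i).
Qed.

Lemma eseries_finite (u : nat -> R) N : (forall M, (N <= M)%N -> u M = 0) ->
  (\sum_(0 <= t <oo) (u t)%:E = (\sum_(t < N) u t)%:E)%E.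
Proof.
move=> u0; rewrite -(big_mkord xpredT u) -sumEFin; apply/cvg_lim => //.
apply: (@cvg_near_cst); near=> n.
have leN : (N <= n)%N by near: n; exists N.
rewrite (big_cat_nat (leq0n N) leN) //= [X in (_ + X)%E]big_nat_cond.
rewrite [X in (_ + X)%E]big1 ?adde0 //.
by move=> t /andP[/andP[leNt _] _]; rewrite u0.
Unshelve. all: by end_near. Qed.

Lemma run_expected_time ans (c : config) (r : R) : run ans c r ->
  (expected_time R c <= r%:E)%E.
Proof.
move=> /run_prob_time[N PN]; have [_ sum1 le_r] := PN N (leqnn N).
rewrite /expected_time (@eseries_finite (fun t => t%:R * prob_time R c t) N).
  2: by move=> M /PN[-> _ _]; rewrite mulr0.
rewrite (@eseries_finite (prob_time R c) N); last by move=> M /PN[].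
(* The probability of running forever is 0, so the infinite term vanishes. *)
by rewrite sum1 subee // mule0 adde0 lee_fin.
Qed.

End ExpectedTimeBound.

Local Notation vStrat := (2%N).
Local Notation vRows := (3%N).
Local Notation vCols := (4%N).
Local Notation vStack := (5%N).
Local Notation vRoot := (6%N).
Local Notation vGo := (7%N).
Local Notation vRow := (8%N).
Local Notation vCol := (9%N).
Local Notation vA := (10%N).
Local Notation vB := (11%N).
Local Notation vC := (12%N).
Local Notation vFree := (13%N).

(** * The program *)

Section Machine.
Local Open Scope nat_scope.

Definition data_of_bool (b : bool) : data := if b then DCons DNil DNil else DNil.

Definition data_of_nat (n : nat) : data := iter n (DCons DNil) DNil.

(* An answer has an empty head, a query does not. *)
Fixpoint data_of_strategy (s : strategy) : data :=
  match s with
  | Answer b => DCons DNil (data_of_bool b)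
  | Query i j s1 s0 =>
      DCons (DCons (data_of_nat i) (data_of_nat j))
            (DCons (data_of_strategy s1) (data_of_strategy s0))
  end.

(* The result goes to variable n; the variables from n on are scratch space. *)
Fixpoint build (n : nat) (d : data) : program :=
  if d is DCons a b then build n a ++ build n.+1 b ++ [:: Assign n (OpCons n n.+1)]
  else [:: Assign n OpNil].

Fixpoint build_time (d : data) : nat :=
  if d is DCons a b then (build_time a + build_time b).+1 else 1.

(** [vA], [vB], [vC] have consecutive numbers, so [vA + i] addresses the one for child [i]. The
    reversal makes up for consing at the front. *)
Definition arrange (v : nat) (p : seq 'I_3) : program :=
  Assign v OpNil ::
  [seq Assign v (OpCons (vA + (i : 'I_3)) v) | i <- rev p].

(** [vA], [vB], [vC] receive the suffixes of the child list that start at children 0, 1 and 2. Such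
    a suffix is empty exactly when the child is missing. *)
Definition load (v x : nat) : program :=
  [:: Assign vA (OpHd x); Assign vB (OpTl vA); Assign vC (OpTl vB);
      Choose (arrange v (head [::] perms3)) [seq arrange v p | p <- behead perms3]].

Definition select (x v : nat) : program :=
  [:: While vA [:: Assign v (OpTl v); Assign vA (OpTl vA)]; Assign x (OpHd v)].

Definition assign_answer (b : bool) : program :=
  build vFree (data_of_strategy (Answer b)) ++ [:: Assign vStrat (OpVar vFree)].

Definition push : program :=
  [:: Assign vA (OpCons vRows vCols); Assign vB (OpTl vStrat);
      Assign vA (OpCons vB vA); Assign vStack (OpCons vA vStack)].

(** [select] consumes the list it walks along. In the main loop [push] has saved both lists
    beforehand. *)
Definition locate : program :=
  Assign vB (OpHd vStrat) :: Assign vA (OpHd vB) :: select vRow vRows ++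
  Assign vA (OpTl vB) :: select vCol vCols.

(** The order of the tests agrees with [embeds]. Two actual children start a new comparison, in
    fresh random orders. *)
Definition descend : command :=
  If vRow
    [:: If vCol
          (load vRows vRow ++ load vCols vCol ++ [:: Assign vStrat (OpVar vRoot)])
          (assign_answer false)]
    (assign_answer true).

Definition pop : program :=
  [:: Assign vA (OpTl vStrat); Assign vB (OpHd vStack); Assign vStack (OpTl vStack);
      Assign vCols (OpTl vB); Assign vRows (OpHd vCols); Assign vCols (OpTl vCols);
      Assign vB (OpHd vB);
      If vA [:: Assign vStrat (OpHd vB)] [:: Assign vStrat (OpTl vB)]].

Definition finish : program := [:: Assign 0 (OpTl vStrat); Assign vGo OpNil].

(* While a query is pending, its frame on the stack holds its two branches and
   the rows and columns it refers to. *)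
Definition main_loop : command :=
  While vGo [:: Assign vA (OpHd vStrat);
                If vA (push ++ locate ++ [:: descend]) [:: If vStack pop finish]].

(** The roots are compared by a strategy of one query on one-element lists, so the main loop treats
    them like any other pair. *)
Definition compare_trees : program :=
  build vFree (data_of_strategy match_strategy) ++ Assign vRoot (OpVar vFree) ::
  build vFree (data_of_strategy (Query o0 o0 (Answer true) (Answer false))) ++
  [:: Assign vStrat (OpVar vFree); Assign vGo (OpVar vFree); Assign vA OpNil;
      Assign vRow (OpCons 0 vA); Assign vRows (OpCons vRow vA);
      Assign vCol (OpCons 1 vA); Assign vCols (OpCons vCol vA); main_loop].

(* The tree, if there is one, is the head of a list cell whose tail is junk. *)
Definition stores_tree (d : data) (x : option rtree) : Prop :=
  if x is Some t then exists l, d = DCons (encode t) l else d = DNil.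

Definition stores_trees (d : data) (xs : 'I_3 -> option rtree) : Prop :=
  forall i : 'I_3, stores_tree (hd (iter i tl d)) (xs i).

End Machine.

(** * Step counts and simulation of a strategy by the main loop *)

Section Simulation.
Variables (F : realFieldType) (ans : bool).
Local Notation run := (@run F ans).

Lemma run_build n d k s r :
    (forall s', s' n = d -> (forall m, (m < n)%N -> s' m = s m) -> run (k, s') r) ->
  run (build n d ++ k, s) (r + (build_time d)%:R).
Proof.
elim: d n k s r => [|a IHa b IHb] n k s r run_k /=.
  apply: run_assign; rewrite addrK; apply: run_k; first by rewrite /update eqxx.
  by move=> m; rewrite /update; case: ltngtP.
rewrite -!catA -natr1 natrD.
have -> : r + ((build_time a)%:R + (build_time b)%:R + 1)
  = r + 1 + (build_time b)%:R + (build_time a)%:R :> F by ring.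
apply: IHa => s1 s1n s1m; apply: IHb => s2 s2n s2m /=.
apply: run_assign; rewrite addrK; apply: run_k => [|m lt_m].
  by rewrite /update eqxx /= s2n s2m // s1n.
by rewrite /update; case: ltngtP lt_m => // lt_m _; rewrite s2m ?s1m // ltnW.
Qed.

Lemma updateE s x d y : update s x d y = if y == x then d else s y.
Proof. by []. Qed.

Lemma run_skip v i k s r : v != vA -> s vA = data_of_nat i ->
    (forall s', s' v = iter i tl (s v) ->
       (forall m, m != v -> m != vA -> s' m = s m) -> run (k, s') r) ->
  run (While vA [:: Assign v (OpTl v); Assign vA (OpTl vA)] :: k, s) (r + (3 * i + 1)%:R).
Proof.
move=> neq_v; elim: i s => [|i IH] s sA run_k; apply: run_while; rewrite sA /=.
  by rewrite addrK; apply: run_k.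
apply: run_assign; apply: run_assign.
have -> : r + (3 * i.+1 + 1)%:R - 1 - 1 - 1 = r + (3 * i + 1)%:R.
  by rewrite mulnS -addnA natrD; ring.
apply: IH => [|s' s'v s'm]; first by rewrite !updateE eqxx /= updateE eq_sym (negPf neq_v) sA.
apply: run_k => [|m neq_mv neq_mA].
  by rewrite s'v !updateE (negPf neq_v) eqxx iterSr.
by rewrite s'm // !updateE (negPf neq_mv) (negPf neq_mA).
Qed.

Lemma run_select x v (i : 'I_3) k s r : v != vA -> s vA = data_of_nat i ->
    (forall s', s' x = hd (iter i tl (s v)) ->
       (forall m, m != x -> m != v -> m != vA -> s' m = s m) -> run (k, s') r) ->
  run (select x v ++ k, s) (r + 8%:R).
Proof.
(* An index is at most 2, so the loop takes at most 7 steps and the final assignment one. *)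
move=> neq_v sA run_k; apply: (@run_le _ _ _ (r + 1 + (3 * i + 1)%:R)).
  rewrite -addrA lerD2l addrC natr1 ler_nat.
  by case: i {sA run_k} => [[|[|[|//]]] ?].
rewrite /select /=; apply: run_skip => // s' s'v s'm.
apply: run_assign; rewrite addrK; apply: run_k; first by rewrite updateE eqxx /= s'v.
by move=> m neq_x neq_mv neq_mA; rewrite updateE (negPf neq_x) s'm.
Qed.

Lemma run_conses v p k s r : (v < vA)%N ->
    (forall s', s' v = foldr (fun i : 'I_3 => DCons (s (vA + i)%N)) (s v) p ->
       (forall m, m != v -> s' m = s m) -> run (k, s') r) ->
  run ([seq Assign v (OpCons (vA + (i : 'I_3)) v) | i <- rev p] ++ k, s) (r + (size p)%:R).
Proof.
move=> lt_v; elim: p k r => [|i p IH] k r run_k; first by rewrite addr0; apply: run_k.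
rewrite rev_cons map_rcons cat_rcons /= -natr1 [_ + 1]addrC addrA; apply: IH => s' s'v s'm.
apply: run_assign; rewrite addrK; apply: run_k => [|m neq_mv].
  by rewrite updateE eqxx /= s'v s'm // gtn_eqF // ltn_addr.
by rewrite updateE (negPf neq_mv) s'm.
Qed.

Lemma stores_kids t (i : 'I_3) : stores_tree (iter i tl (encode t)) (kids t i).
Proof.
case: t => ts; rewrite /kids /=; elim: ts (nat_of_ord i) => [|t ts IH] [|k] /=.
- by [].
- by elim: k => //= k ->.
- by eexists.
- by rewrite -iterS iterSr /= ltnS; apply: IH.
Qed.

Lemma run_load v x t l k s r (f : seq 'I_3 -> F) :
    (v < vA)%N -> s x = DCons (encode t) l ->
    (forall p, p \in perms3 ->
       forall s', stores_trees (s' v) (fun i => kids t (sel p i)) ->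
       (forall m, (m < vA)%N -> m != v -> s' m = s m) -> run (k, s') (f p)) ->
    \sum_(p <- perms3) f p <= 6%:R * r ->
  run (load v x ++ k, s) (r + 8%:R).
Proof.
move=> lt_v sx run_k le_r; rewrite /load /=.
do 3![apply: run_assign].
set s1 := update _ vC _.
have s1_kids (i : 'I_3) : stores_tree (s1 (vA + i)%N) (kids t i).
  have -> : s1 (vA + i)%N = iter i tl (encode t).
    by case: i => [[|[|[|//]]] ?]; rewrite /s1 /update /= sx.
  exact: stores_kids.
have s1_old m : (m < vA)%N -> s1 m = s m.
  move=> lt_m; rewrite /s1 !updateE !ltn_eqF //; lia.
(* Of the 8 steps, three come before the choice, the choice is one, and each arrangement takes
   four. *)
apply: (@run_choose _ _ _ (head [::] perms3) (behead perms3) (arrange v) _ _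
  (fun p => f p + 4%:R)) => [p p_in|].
  have sz_p : size p = 3.
    by have /allP/(_ p p_in)/eqP := (isT : all (fun p => size p == 3) perms3).
  rewrite /arrange cat_cons.
  apply: run_assign; have -> : f p + 4%:R - 1 = f p + (size p)%:R by rewrite sz_p; ring.
  apply: run_conses => // s' s'v s'm; apply: run_k => // [i|m lt_m neq_m].
    rewrite s'v updateE eqxx /=.
    have : stores_tree (s1 (vA + sel p i)) (kids t (sel p i)) by exact: s1_kids.
    rewrite /sel.
    case: p sz_p {p_in s'v} => [|a [|b [|c [|//]]]] // _.
    case: i => [[|[|[|//]]] ?] /=; rewrite updateE gtn_eqF // ?ltn_addr //.
  by rewrite s'm // updateE (negPf neq_m) s1_old.
rewrite big_split /= -[_ :: _]/perms3.
have -> : \sum_(i <- perms3) 4%:R = 24%:R :> F by rewrite !big_cons big_nil; ring.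
by move: le_r; lra.
Qed.

Definition ready (s : store) : Prop :=
  s vRoot = data_of_strategy match_strategy /\ is_cons (s vGo).

Definition frame (s1 s0 : strategy) (R C : data) : data :=
  DCons (DCons (data_of_strategy s1) (data_of_strategy s0)) (DCons R C).

Lemma run_pop b s1 s0 R C d s r : ready s ->
    s vStrat = data_of_strategy (Answer b) -> s vStack = DCons (frame s1 s0 R C) d ->
    (forall s', ready s' -> s' vStrat = data_of_strategy (if b then s1 else s0) ->
       s' vRows = R -> s' vCols = C -> s' vStack = d -> run ([:: main_loop], s') r) ->
  run ([:: main_loop], s) (r + 13%:R).
Proof.
move=> [s_root s_go] s_strat s_stack run_k.
rewrite /main_loop; apply: run_while; rewrite s_go /=.
apply: run_assign; apply: run_if; rewrite [X in is_cons X]/update /= s_strat /=.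
apply: run_if; rewrite [X in is_cons X]/update /= s_stack /=.
do 7![apply: run_assign]; apply: run_if.
set s2 := update _ _ _.
have -> : is_cons (s2 vA) = b by rewrite /s2 /update /= s_strat; case: (b).
apply: (@run_le _ _ _ (r + 1)); first by lra.
have -> : (if b then [:: Assign vStrat (OpHd vB)] else [:: Assign vStrat (OpTl vB)])
  = [:: Assign vStrat (if b then OpHd vB else OpTl vB)] by case: (b).
apply: run_assign; rewrite addrK.
by apply: run_k; rewrite ?/ready /s2 /update /= ?s_stack //; case: (b).
Qed.

Lemma run_query i j s1 s0 rows cols s r : ready s ->
    s vStrat = data_of_strategy (Query i j s1 s0) ->
    stores_trees (s vRows) rows -> stores_trees (s vCols) cols ->
    (forall s', ready s' ->
       s' vStack = DCons (frame s1 s0 (s vRows) (s vCols)) (s vStack) ->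
       stores_tree (s' vRow) (rows i) -> stores_tree (s' vCol) (cols j) ->
       run ([:: descend; main_loop], s') r) ->
  run ([:: main_loop], s) (r + 26%:R).
Proof.
move=> [s_root s_go] s_strat s_rows s_cols run_k.
rewrite /main_loop; apply: run_while; rewrite s_go /=.
apply: run_assign; apply: run_if; rewrite [X in is_cons X]/update /= s_strat /=.
do 6![apply: run_assign].
(* The remaining 17 steps are two selections and the assignment between them. *)
have -> : r + 26%:R - 1 - 1 - 1 - 1 - 1 - 1 - 1 - 1 - 1 = r + 8%:R + 1 + 8%:R by ring.
set t := update _ vA (eval_op _ (OpHd vB)).
have t_val m : t m = if m == vA then data_of_nat i else
    if m == vB then DCons (data_of_nat i) (data_of_nat j) else
    if m == vStack then DCons (frame s1 s0 (s vRows) (s vCols)) (s vStack) else s m.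
  rewrite /t /update /= s_strat /=.
  by case: (m == vA); case: (m == vB); case: (m == vStack).
clearbody t.
apply: (@run_select vRow vRows i) => // t1 t1_row t1_old.
apply: run_assign; rewrite addrK.
apply: (@run_select vCol vCols j) => // [|t2 t2_col t2_old].
  by rewrite updateE /= t1_old // t_val.
have t2_s m : (m < vA)%N -> m != vRow -> m != vCol -> m != vRows -> m != vCols ->
    t2 m = t m.
  move=> lt_m ? ? ? ?; have ? : m != vA by rewrite ltn_eqF.
  by rewrite t2_old // updateE ifN // t1_old.
apply: run_k.
- by rewrite /ready !t2_s // !t_val.
- by rewrite t2_s // t_val.
- by rewrite t2_old // updateE /= t1_row t_val; apply: s_rows.
- by rewrite t2_col updateE /= t1_old // t_val; apply: s_cols.
Qed.

Lemma run_assign_answer b k s r :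
    (forall s', s' vStrat = data_of_strategy (Answer b) ->
       (forall m, (m < vA)%N -> m != vStrat -> s' m = s m) -> run (k, s') r) ->
  run (assign_answer b ++ k, s) (r + 6%:R).
Proof.
move=> run_k; rewrite /assign_answer -catA.
apply: (@run_le _ _ _ (r + 1 + (build_time (data_of_strategy (Answer b)))%:R)).
  by rewrite -addrA lerD2l addrC natr1 ler_nat; case: (b).
apply: run_build => s1 s1_b s1_old; apply: run_assign; rewrite addrK.
apply: run_k => [|m lt_m neq_m]; first by rewrite updateE /= s1_b.
by rewrite updateE (negPf neq_m) s1_old // (leq_trans lt_m).
Qed.

Definition sub_cost (c : rtree -> rtree -> F) (x y : option rtree) : F :=
  match x, y with Some H, Some G => c H G | _, _ => 0 end.

(* 100 is more than the number of steps spent on one query, apart from those spent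
   on the queries of the comparison that it starts. *)
Definition query_cost c (rows cols : 'I_3 -> option rtree) (s : strategy) : F :=
  \sum_(ij <- queries s (fun i j => embeds (rows i) (cols j)))
    (100%:R + sub_cost c (rows ij.1) (cols ij.2)).

(** The recursive inequality for the cost of a comparison, averaged over the 36 pairs of orders and
    cleared of the denominator. *)
Definition supersolution (c : rtree -> rtree -> F) : Prop :=
  forall H G, ternary H -> ternary G ->
  \sum_(p <- perms3) \sum_(q <- perms3)
    query_cost c (fun i => kids H (sel p i)) (fun j => kids G (sel q j)) match_strategy
  <= 36%:R * c H G.

Definition vertices (x : option rtree) : nat := if x is Some t then num_vertices t else 0.

Definition ternary_opt (x : option rtree) : bool := if x is Some t then ternary t else true.

Lemma vertices_kids t i : (vertices (kids t i) < num_vertices t)%N.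
Proof.
case: t => ts; rewrite /kids /= ltnS; elim: ts (nat_of_ord i) => [|t ts IH] [|k] //=.
  exact: leq_addr.
by rewrite ltnS; apply: leq_trans (IH k) (leq_addl _ _).
Qed.

Lemma ternary_kids t i : ternary t -> ternary_opt (kids t i).
Proof.
case: t => ts /= /andP[_ /(all_nthP (Node [::])) ts3]; rewrite /kids /=.
by case: ltnP => //= /ts3.
Qed.

Definition returns b d r : Prop := forall s, ready s ->
  s vStrat = data_of_strategy (Answer b) -> s vStack = d -> run ([:: main_loop], s) r.

(** The outer induction, on a bound for the sizes of the row trees, handles the comparison started
    by a query. The inner one, on the strategy, handles the branch resumed after its answer.
    [returns] is the continuation, with an arbitrary stack. *)
Lemma run_strategy c n : supersolution c ->
  forall s rows cols d st r,
    (forall i, (vertices (rows i) < n)%N && ternary_opt (rows i)) ->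
    (forall j, ternary_opt (cols j)) ->
    ready st -> st vStrat = data_of_strategy s ->
    stores_trees (st vRows) rows -> stores_trees (st vCols) cols -> st vStack = d ->
    returns (outcome s (fun i j => embeds (rows i) (cols j))) d r ->
  run ([:: main_loop], st) (r + query_cost c rows cols s).
Proof.
move=> c_super; elim: n => [|n IHn]; first by move=> s rows cols d st r /(_ o0).
elim=> [b|i j s1 IH1 s0 IH0] rows cols d st r rows_n cols3 st_ok st_s st_rows st_cols st_d.
  by rewrite /query_cost big_nil addr0 => run_r; apply: run_r.
set M := (fun i j => embeds (rows i) (cols j)) => run_r.
have run_branch : returns (M i j) (DCons (frame s1 s0 (st vRows) (st vCols)) d)
    (r + query_cost c rows cols (if M i j then s1 else s0) + 13%:R).
  move=> t t_ok t_b t_d; apply: (run_pop t_ok t_b t_d) => u u_ok u_s u_rows u_cols u_d.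
  move: run_r u_s; rewrite /= -/M.
  case: (M i j) => run_r u_s; [apply: (IH1 _ _ d)|apply: (IH0 _ _ d)] => //;
    by rewrite ?u_rows ?u_cols.
rewrite /query_cost /= big_cons -/M /=.
have -> : \sum_(ij <- queries (if M i j then s1 else s0) M)
   (100%:R + sub_cost c (rows ij.1) (cols ij.2))
   = query_cost c rows cols (if M i j then s1 else s0) by [].
move: run_branch; set rest := r + query_cost _ _ _ _ + _ => run_branch.
(* Besides the 13 steps for popping contained in [rest], 26 go to the query and at most 19 to
   [descend]: 58 in all, below the allowance of 100. *)
apply: (@run_le _ _ _ (rest + sub_cost c (rows i) (cols j) + 19%:R + 26%:R)).
  by rewrite /rest; lra.
apply: (run_query st_ok st_s st_rows st_cols) => t t_ok.
rewrite st_d => t_d t_row t_col.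
rewrite /descend; apply: run_if; move: t_row t_col (rows_n i) (cols3 j) run_branch.
rewrite /M; case: (rows i) => [H|] /=; last first.
  move=> t_row _ _ _ run_branch; rewrite t_row.
  apply: (@run_le _ _ _ (rest + 6%:R)); first lra.
  apply: run_assign_answer => u u_b u_old; apply: run_branch => //.
  - by case: t_ok => *; split; rewrite u_old.
  - by rewrite u_old.
case=> l def_row t_col /andP[ltHn H3] G3 run_branch; rewrite def_row /=.
apply: run_if; move: t_col G3 run_branch; case: (cols j) => [G|] /=; last first.
  move=> t_col _ run_branch; rewrite t_col.
  apply: (@run_le _ _ _ (rest + 6%:R)); first lra.
  apply: run_assign_answer => u u_b u_old; apply: run_branch => //.
  - by case: t_ok => *; split; rewrite u_old.
  - by rewrite u_old.
case=> l' def_col G3 run_branch; rewrite def_col /=.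
set S := fun p q : seq 'I_3 => query_cost c (fun i => kids H (sel p i))
  (fun j => kids G (sel q j)) match_strategy.
have le_S : \sum_(p <- perms3) \sum_(q <- perms3) S p q <= 36%:R * c H G by apply: c_super.
(* The average over the column orders, plus 8 for loading the columns. Averaging over the row orders
   as well makes [le_S] applicable. *)
pose g p := (\sum_(q <- perms3) (rest + S p q + 1)) / 6%:R + 8%:R.
suff : run (load vRows vRow ++ load vCols vCol ++
            [:: Assign vStrat (OpVar vRoot); main_loop], t)
    (rest + c H G + 9%:R + 8%:R) by apply: run_le; lra.
apply: (@run_load vRows vRow H l _ _ _ g) => // [p p_in t1 t1_rows t1_old|]; last first.
  by move: le_S; rewrite /g /perms3 !big_cons !big_nil; clearbody S; lra.
apply: (@run_load vCols vCol G l' _ _ _ (fun q => rest + S p q + 1)) => //.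
- by rewrite t1_old.
- move=> q q_in t2 t2_cols t2_old; apply: run_assign; rewrite addrK.
  apply: (IHn _ _ _ (DCons (frame s1 s0 (st vRows) (st vCols)) d)).
  + move=> k; rewrite ternary_kids // andbT.
    by apply: leq_trans (vertices_kids _ _) _; rewrite -ltnS.
  + by move=> k; rewrite ternary_kids.
  + by case: t_ok => t_root t_go; split; rewrite updateE /= t2_old ?t1_old.
  + by case: t_ok => t_root t_go; rewrite updateE /= t2_old ?t1_old.
  + by rewrite updateE /= t2_old.
  + by rewrite updateE /=.
  + by rewrite updateE /= t2_old ?t1_old.
  (* The outcome is that of a perfect matching in the permuted matrix, hence in the original one,
     hence that of the embedding. *)
  have := match_strategy_okP (fun i j => embeds (kids H (sel p i)) (kids G (sel q j))).
  case/and4P=> /eqP-> _ _ _.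
  have := match_strategy_okP (fun i j => embeds (kids H i) (kids G j)).
  case/and4P=> _ _ /allP/(_ p p_in)/allP/(_ q q_in)/eqP; rewrite /permuted => -> _.
  by rewrite -embeds_matching.
- by rewrite mulrC divfK ?pnatr_eq0.
Qed.

End Simulation.

(** * The whole run from the initial configuration *)

Section Correctness.
Variable F : realFieldType.

(** The 115 consists of 100 for the query on the roots, 7 for finishing, and 8 for the assignments
    outside the two builds. *)
Definition setup_time : F :=
  (build_time (data_of_strategy match_strategy)
   + build_time (data_of_strategy (Query o0 o0 (Answer true) (Answer false))) + 115)%:R.

Lemma run_finish b s : ready s -> s vStrat = data_of_strategy (Answer b) ->
  s vStack = DNil -> run b ([:: main_loop], s) (7%:R : F).
Proof.
move=> [_ s_go] s_strat s_stack.
rewrite /main_loop; apply: run_while; rewrite s_go /=.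
apply: run_assign; apply: run_if; rewrite [X in is_cons X]/update /= s_strat /=.
apply: run_if; rewrite [X in is_cons X]/update /= s_stack /=.
do 2![apply: run_assign]; apply: run_while; rewrite [X in is_cons X]/update /=.
apply: run_halt; last by lra.
by rewrite /answer /update /= s_strat; case: (b).
Qed.

Lemma run_compare_trees (c : rtree -> rtree -> F) H G :
    supersolution c -> ternary H -> ternary G ->
  run `[< subtree_iso H G >] (initial compare_trees H G) (c H G + setup_time).
Proof.
move=> c_super H3 G3; rewrite /initial /compare_trees /setup_time.
set st := (fun x : nat => _).
set m := build_time _; set n := build_time _.
have -> : c H G + (m + n + 115)%:R = c H G + 107%:R + 7%:R + n%:R + 1 + m%:R.
  by rewrite !natrD; ring.
apply: run_build => s1 s1_free s1_old; apply: run_assign; rewrite addrK.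
apply: run_build => s2 s2_free s2_old /=.
do 7![apply: run_assign].
set s3 := update _ vCols _.
have s2_st m' : (m' < vRoot)%N -> s2 m' = st m'.
  move=> lt_m; rewrite s2_old ?(leq_trans lt_m) // updateE ltn_eqF //.
  by rewrite s1_old // (leq_trans lt_m).
have s3_root : s3 vRoot = data_of_strategy match_strategy.
  by rewrite /s3 /update /= s2_old //= /update /= s1_free.
pose rows (t : rtree) (i : 'I_3) := if val i is 0%N then Some t else None.
have cost0 : query_cost c (rows H) (rows G) (Query o0 o0 (Answer true) (Answer false))
    = 100%:R + c H G.
  by rewrite /query_cost /= big_cons; case: asboolP; rewrite /= big_nil addr0.
apply: (@run_le _ _ _ (7%:R + query_cost c (rows H) (rows G)
    (Query o0 o0 (Answer true) (Answer false)))); first by rewrite cost0; lra.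
apply: (@run_strategy _ _ _ (num_vertices H).+1 _ _ _ _ DNil) => //.
- by case=> [[|[|[|//]]] ?] /=; rewrite ?ltnS ?leqnn.
- by case=> [[|[|[|//]]] ?].
- by split => //; rewrite /s3 /update /= s2_free.
- case=> [[|[|[|//]]] ?] //=; exists DNil.
  by rewrite /s3 /update /= s2_st.
- case=> [[|[|[|//]]] ?] //=; exists DNil.
  by rewrite /s3 /update /= s2_st.
- by rewrite /s3 /update /= s2_st.
move=> s s_ok s_b s_nil; apply: run_finish => //.
by rewrite s_b /=; case: asboolP.
Qed.

End Correctness.

(** * The two supersolutions *)

Section Costs.
Variable F : realFieldType.

Lemma height_kids t i u : kids t i = Some u -> (height u < height t)%N.
Proof.
case: t => ts; rewrite /kids /=; case: ltnP => //= lt_i [<-] {u}.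
elim: ts (nat_of_ord i) lt_i => //= t ts IH [|k] /= lt_k; first exact: leq_maxl.
by apply: leq_trans (IH k lt_k) (leq_maxr _ _).
Qed.

Definition rate : F := 6107%:R / 1000%:R.

(* The factor 118 is there to make 218 * (100 + A * x) <= 36 * 6.107 * A * x for
   x >= 1, where A = 118 * 100. *)
Definition height_cost (H G : rtree) : F :=
  118%:R * 100%:R * rate ^+ maxn (height H) (height G).

(** Every query is charged the same amount [X], chosen so that 218 queries cost exactly
    [36 * height_cost H G]. Only the total number of queries over the 36 permuted matrices then
    matters. *)
Lemma height_cost_supersolution : supersolution height_cost.
Proof.
move=> H G _ _; pose l := rate.
have l1 : 1 <= l by rewrite /l /rate; lra.
set h := maxn (height H) (height G); pose X := 36%:R * height_cost H G / 218%:R.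
have lh1 : 1 <= l ^+ h by rewrite exprn_ege1.
have XE : X = 36%:R * (118%:R * 100%:R * l ^+ h) / 218%:R by [].
have X_ge100 : 100%:R <= X by rewrite XE; move: lh1; move: (l ^+ h) => y1; lra.
have X0 : 0 <= X := le_trans (ler0n F 100) X_ge100.
have X_ge x y : 100%:R + sub_cost height_cost (kids H x) (kids G y) <= X.
  case kidH: (kids H x) => [H'|] /=; last by rewrite addr0.
  case kidG: (kids G y) => [G'|] /=; last by rewrite addr0.
  rewrite /height_cost; set m := maxn _ _.
  have lt_m : (m < h)%N.
    by rewrite /m /h gtn_max !leq_max (height_kids kidH) (height_kids kidG) orbT.
  (* The maximal height drops by at least one, which gains a factor [l] against 218/36. *)
  have : l ^+ m.+1 <= l ^+ h by rewrite ler_weXn2l.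
  have : 1 <= l ^+ m by rewrite exprn_ege1.
  rewrite XE exprS; rewrite -/l; move: (l ^+ m) (l ^+ h) => y1 y2; rewrite /l /rate; lra.
have sum_X (s : seq ('I_3 * 'I_3)) : \sum_(ij <- s) X = (size s)%:R * X.
  by elim: s => [|ij s IH]; rewrite ?big_nil ?mul0r // big_cons IH -nat1r mulrDl mul1r.
have le_query p q : query_cost height_cost (fun i => kids H (sel p i))
    (fun j => kids G (sel q j)) match_strategy
  <= (size (queries match_strategy
       (permuted p q (fun i j => embeds (kids H i) (kids G j)))))%:R * X.
  rewrite /query_cost -sum_X.
  by apply: ler_sum => ij _; apply: X_ge.
apply: (@le_trans _ _ (218%:R * X)); last by rewrite /X; lra.
apply: le_trans (ler_sum _ (fun p _ => ler_sum _ (fun q _ => le_query p q))) _.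
have /and4P[_ _ _] := match_strategy_okP (fun i j => embeds (kids H i) (kids G j)).
rewrite sumnE big_allpairs_dep -(ler_nat F) => le_218.
apply: le_trans (ler_wpM2r X0 le_218).
rewrite natr_sum mulr_suml; apply: ler_sum => p _.
by rewrite natr_sum mulr_suml.
Qed.

Definition size_cost (H G : rtree) : F :=
  900%:R * (num_vertices H)%:R * (num_vertices G)%:R.

Lemma sum_vertices_kids t : (\sum_i vertices (kids t i) < num_vertices t)%N.
Proof.
case: t => ts; rewrite !big_ord_recl big_ord0 /kids /= ltnS.
case: ts => [|t0 [|t1 [|t2 ts]]] /=; lia.
Qed.

Lemma sum_perms3 (p : seq 'I_3) (f : 'I_3 -> F) : p \in perms3 ->
  \sum_i f (sel p i) = \sum_i f i.
Proof.
move=> p_in; rewrite [RHS](reindex_inj (h := sel p)) // => i j eq_ij.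
by apply: val_inj; apply: (perms3_inj p_in) => //; apply: ltn_ord.
Qed.

(** Distinct queries cost at most the sum over all nine entries, [900 + 900 * x * y] for total child
    sizes [x] and [y]. This is at most [900 * (x + 1) * (y + 1)], for every pair of orders. *)
Lemma size_cost_supersolution : supersolution size_cost.
Proof.
move=> H G _ _.
pose f t i : F := (vertices (kids t i))%:R.
have sub_costE i j : sub_cost size_cost (kids H i) (kids G j) = 900%:R * f H i * f G j.
  by rewrite /f; case: (kids H i) (kids G j) => [?|] [?|]; rewrite /= ?mulr0 ?mul0r.
have f_lt t : \sum_i f t i + 1 <= (num_vertices t)%:R.
  by rewrite /f -natr_sum natr1 ler_nat; apply: sum_vertices_kids.
have f_ge0 t : 0 <= \sum_i f t i by apply: sumr_ge0 => i _; rewrite ler0n.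
have le_query p q : p \in perms3 -> q \in perms3 ->
    query_cost size_cost (fun i => kids H (sel p i)) (fun j => kids G (sel q j)) match_strategy
    <= size_cost H G.
  move=> p_in q_in; rewrite /query_cost.
  have /and4P[_ uniq_q _ _] :=
    match_strategy_okP (fun i j => embeds (kids H (sel p i)) (kids G (sel q j))).
  rewrite big_uniq //=.
  apply: (@le_trans _ _ (\sum_(ij : 'I_3 * 'I_3)
      (100%:R + 900%:R * f H (sel p ij.1) * f G (sel q ij.2)))).
    rewrite [leRHS](bigID (mem (queries match_strategy
      (fun i j => embeds (kids H (sel p i)) (kids G (sel q j)))))) /=.
    rewrite (eq_bigr (fun ij => 100%:R + 900%:R * f H (sel p ij.1) * f G (sel q ij.2))).
      2: by move=> ij _; rewrite sub_costE.
    rewrite lerDl; apply: sumr_ge0 => ij _; apply: addr_ge0; first exact: ler0n.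
    by apply: mulr_ge0; [apply: mulr_ge0|]; apply: ler0n.
  rewrite big_split /= sumr_const card_prod !card_ord.
  have -> : \sum_(ij : 'I_3 * 'I_3) 900%:R * f H (sel p ij.1) * f G (sel q ij.2)
      = 900%:R * (\sum_i f H i) * (\sum_j f G j).
    rewrite -(pair_big xpredT xpredT (fun i j => 900%:R * f H (sel p i) * f G (sel q j))) /=.
    under eq_bigr do rewrite -mulr_sumr (sum_perms3 (f G) q_in).
    by rewrite -mulr_suml -mulr_sumr (sum_perms3 (f H) p_in).
  rewrite /size_cost -[100%:R *+ _]mulr_natr.
  move: (f_lt H) (f_lt G) (f_ge0 H) (f_ge0 G).
  set x := \sum_i f H i; set y := \sum_i f G i => *.
  apply: (@le_trans _ _ (900%:R * (x + 1) * (y + 1))); first by nra.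
  by rewrite -!mulrA ler_pM2l ?ltr0n // ler_pM // addr_ge0.
apply: (@le_trans _ _ (\sum_(p <- perms3) \sum_(q <- perms3) size_cost H G)).
  rewrite big_seq [leRHS]big_seq; apply: ler_sum => p p_in.
  by rewrite big_seq [leRHS]big_seq; apply: ler_sum => q q_in; apply: le_query.
by rewrite /perms3 !big_cons !big_nil; lra.
Qed.

End Costs.

(** * Correctness and the combined bound *)

Theorem theorem1p3 :
  exists P : program,
    always_correct_on_ternary P /\
    forall (R : realType) (a : R), exists C : R,
      forall (n h : nat) (H G : rtree),
        ternary H -> ternary G ->
        (num_vertices H)%:R <= a * n%:R ->
        (num_vertices G)%:R <= a * n%:R ->
        (height H <= h)%N -> (height G <= h)%N ->
        (expected_time R (initial P H G)
           <= (C * Num.min ((6107%:R / 1000%:R) ^+ h) (n%:R ^+ 2))%:E)%E.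
Proof.
exists compare_trees; split=> [H G H3 G3 c reach_c halt_c|R a].
  (* Any supersolution certifies the answer; here it is the quadratic one over [rat]. *)
  have run_c := run_compare_trees (@size_cost_supersolution rat) H3 G3.
  by rewrite (run_answer run_c reach_c halt_c); split=> /asboolP.
rewrite -/(rate R); set l := rate R; set K := setup_time R.
have K0 : 0 <= K by apply: ler0n.
have K900 : 0 <= 900%:R + K := addr_ge0 (ler0n R 900) K0.
(* The sum of the constants of the two bounds; both are nonnegative, so it dominates each. *)
exists (118%:R * 100%:R + K + (900%:R + K) * a ^+ 2) => n h H G H3 G3 leH leG hH hG.
have lh1 : 1 <= l ^+ h by rewrite exprn_ege1 // /l /rate; lra.
have bound_h : height_cost R H G + K <= (118%:R * 100%:R + K) * l ^+ h.
  have : height_cost R H G <= 118%:R * 100%:R * l ^+ h.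
    by rewrite ler_pM2l ?mulr_gt0 ?ltr0n // ler_weXn2l ?geq_max ?hH ?hG // /l /rate; lra.
  by move: lh1; set y := l ^+ h; nra.
have bound_n : size_cost R H G + K <= (900%:R + K) * (a ^+ 2 * n%:R ^+ 2).
  (* Since every tree has a vertex, [K] is at most [K * (x * y)], and [z] is at least 1 whatever the
     sign of [a]. *)
  have vert1 t : 1 <= (num_vertices t)%:R :> R by rewrite ler1n; case: t.
  rewrite -exprMn /size_cost; move: (vert1 H) (vert1 G) leH leG.
  set x := (num_vertices H)%:R; set y := (num_vertices G)%:R; set z := a * n%:R.
  move=> x1 y1 xz yz.
  have xy_z : x * y <= z ^+ 2 by rewrite expr2 ler_pM //; lra.
  have xy1 : 1 <= x * y by rewrite -[1]mulr1 ler_pM.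
  apply: (@le_trans _ _ ((900%:R + K) * (x * y))); last exact: (ler_wpM2l K900 xy_z).
  by rewrite [leRHS]mulrDl -mulrA lerD2l; apply: ler_peMr.
have a2 : 0 <= (900%:R + K) * a ^+ 2 by apply: mulr_ge0 K900 (sqr_ge0 a).
have n2 : 0 <= n%:R ^+ 2 :> R by rewrite sqr_ge0.
(* The same program obeys both bounds; the supersolution used is the one for the smaller term. *)
have [le_hn|lt_nh] := leP (l ^+ h) (n%:R ^+ 2).
  apply: le_trans (run_expected_time (run_compare_trees (@height_cost_supersolution R) H3 G3)) _.
  rewrite lee_fin; apply: le_trans bound_h _.
  by apply: (ler_wpM2r (le_trans ler01 lh1)); rewrite lerDl.
apply: le_trans (run_expected_time (run_compare_trees (@size_cost_supersolution R) H3 G3)) _.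
rewrite lee_fin; apply: le_trans bound_n _; rewrite mulrA.
have A0 : 0 <= 118%:R * 100%:R + K.
  by rewrite addr_ge0 // mulr_ge0 // ler0n.
by apply: (ler_wpM2r n2); rewrite lerDr.
Qed.
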